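(* Let $q$ be a discrete multi-time semi-Markov kernel on $\mathsf X$ with Markov renewal potential $\psi$. Let $G=(G_k)_{k\in\mathbb N^d}$ be a sequence of non-negative measurable functions on $\mathsf X$ and put $L=\psi*G$. Then $L$ is the minimal non-negative solution of the Markov renewal equation $$L=G+q*L.$$ Equivalently, $$L_k(x)=\mathbb E_x\left[\sum_{n\ge0}\mathbf 1_{\{S_n\leq_dk\}}G_{k-S_n}(J_n)\right],\qquad x\in\mathsf X,\ k\in\mathbb N^d.$$
   Context: $\mathbb N=\{0,1,2,\dots\}$, $d\ge1$; $r\leq_dk$ means $r_j\le k_j$ for all $j$; $0_d$ is the zero vector. $(\mathsf X,\mathcal X)$ is a standard Borel space. A discrete multi-time semi-Markov kernel is a family $q=(q_k)_{k\in\mathbb N^d}$ of non-negative kernels on $\mathsf X$ with $\sum_kq_k(x,\mathsf X)=1$ for all $x$. The Markov renewal chain $(J_n,S_n)_{n\ge0}$ in $\mathsf X\times\mathbb N^d$ has $S_0=0_d$ and $\mathbb P(J_{n+1}\in A,S_{n+1}-S_n=k\mid J_0,S_0,\dots,J_n,S_n)=q_k(J_n,A)$; $\mathbb E_x$ is expectation when $J_0=x$. For kernel sequences $A,B$ and non-negative function sequences $F$: $(A*B)_k(x,D)=\sum_{r\leq_dk}\int_{\mathsf X}A_r(x,dy)B_{k-r}(y,D)$ and $(A*F)_k(x)=\sum_{r\leq_dk}\int_{\mathsf X}A_r(x,dy)F_{k-r}(y)$. Convolution powers: $q^{(0)}=e$ (with $e_{0_d}=I$, $e_k=0$ for $k\ne0_d$)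 and $q^{(n)}=q*q^{(n-1)}$. The potential is $\psi_k(x,A)=\sum_{n\ge0}q^{(n)}_k(x,A)$. All values are in $[0,\infty]$; minimality is pointwise among non-negative measurable solutions with values in $[0,\infty]$. *)

(* Defs.v *)
From HB Require Import structures.
From mathcomp Require Import all_boot all_order all_algebra.
From mathcomp Require Import all_classical all_reals all_analysis.
From mathcomp Require Import measurable_realfun.

Set Implicit Arguments.
Unset Strict Implicit.
Unset Printing Implicit Defensive.

Import Order.TTheory GRing.Theory Num.Theory.
Import numFieldNormedType.Exports.

Local Open Scope classical_set_scope.
Local Open Scope ring_scope.
Local Open Scope ereal_scope.

(** Time vectors in N^d, with the discrete sigma-algebra.  [0] and [+] are the
    pointwise operations inherited from finite functions. *)
Definition mtime (d : nat) := {ffun 'I_d -> nat}.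

HB.instance Definition _ d := GRing.Nmodule.on (mtime d).
HB.instance Definition _ d := isPointed.Build (mtime d) 0%R.
HB.instance Definition _ d := @isMeasurable.Build default_measure_display
  (mtime d) discrete_measurable discrete_measurable0
  discrete_measurableC discrete_measurableU.

Definition mtime_le d (r k : mtime d) : Prop := forall j, (r j <= k j)%N.

(** Truncated at 0 coordinatewise; only used for [r] with [mtime_le r k]. *)
Definition mtime_sub d (k r : mtime d) : mtime d := [ffun j => (k j - r j)%N].

Definition mtime_box d (k : mtime d) : set (mtime d) := [set r | mtime_le r k].

Lemma finite_mtime_box d (k : mtime d) : finite_set (mtime_box k).
Proof.
pose m := (\max_(j < d) k j)%N.
pose h (g : {ffun 'I_d -> 'I_m.+1}) : mtime d := [ffun j => nat_of_ord (g j)].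
apply: (@sub_finite_set _ _ (range h)); last exact/finite_image/finite_finset.
move=> r rk; exists [ffun j => inord (r j)] => //.
apply/ffunP => j; rewrite !ffunE inordK// ltnS (leq_trans (rk j))//.
exact: leq_bigmax.
Qed.

(** Polish space: separable and completely metrizable.  A Hausdorff
    pseudometric space (in the sense of [pseudoMetricType]) is a metric space. *)
Definition polish (R : realType) (Y : completePseudoMetricType R) : Prop :=
  hausdorff_space Y /\ exists2 D : set Y, countable D & dense D.

Definition standard_borel (R : realType) (dX : measure_display)
    (X : measurableType dX) : Prop :=
  exists Y : completePseudoMetricType R, polish Y /\
    exists2 f : X -> Y, bijective f &
      forall B : set Y, measurable (f @^-1` B) <-> <<s open >> B.

Section convolution.
Context (d : nat) (dX : measure_display) (X : measurableType dX) (R : realType).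

Definition semi_markov (q : mtime d -> R.-ker X ~> X) : Prop :=
  forall x, \esum_(k in [set: mtime d]) q k x setT = 1.

Definition conv_set (A B : mtime d -> R.-ker X ~> X) (k : mtime d)
    (x : X) (D : set X) : \bar R :=
  \sum_(r \in mtime_box k) \int[A r x]_y B (mtime_sub k r) y D.

Definition conv_fun (A : mtime d -> R.-ker X ~> X)
    (F : mtime d -> X -> \bar R) (k : mtime d) (x : X) : \bar R :=
  \sum_(r \in mtime_box k) \int[A r x]_y F (mtime_sub k r) y.

Section conv_kernel.
Variables (A B : mtime d -> R.-ker X ~> X) (k : mtime d).

Let conv_set0 x : conv_set A B k x set0 = 0.
Proof. by apply: fsbig1 => r _; apply: integral0_eq => y _; rewrite measure0. Qed.

Let conv_set_ge0 x D : 0 <= conv_set A B k x D.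
Proof. by apply: fsume_ge0 => r _; exact: integral_ge0. Qed.

Let conv_set_sigma_additive x : semi_sigma_additive (conv_set A B k x).
Proof.
move=> F mF tF mUF.
have -> : conv_set A B k x (\bigcup_n F n) =
    \sum_(0 <= n <oo) conv_set A B k x (F n).
  rewrite /conv_set fsbig_finite/=; last exact: finite_mtime_box.
  under eq_eseriesr do
    (rewrite fsbig_finite/=; last exact: finite_mtime_box).
  rewrite nneseries_sum; last by move=> r n _; apply: integral_ge0.
  apply: eq_bigr => r _.
  rewrite -integral_nneseries//; last by move=> n; exact: measurable_kernel.
  by apply: eq_integral => y _; rewrite measure_semi_bigcup.
by apply: is_cvg_nneseries => n _ _; exact: conv_set_ge0.
Qed.

HB.instance Definition _ x := isMeasure.Build _ _ _ (conv_set A B k x)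
  (conv_set0 x) (conv_set_ge0 x) (@conv_set_sigma_additive x).

Definition conv_measure : X -> {measure set X -> \bar R} := conv_set A B k.

Let measurable_conv U :
  measurable U -> measurable_fun [set: X] (conv_measure ^~ U).
Proof.
move=> mU; apply: emeasurable_fsum => [|r]; first exact: finite_mtime_box.
apply: measurable_fun_integral_kernel => //; last exact: measurable_kernel.
by move=> V mV; exact: measurable_kernel.
Qed.

HB.instance Definition _ := isKernel.Build _ _ _ _ _
  conv_measure measurable_conv.

Definition conv : R.-ker X ~> X := conv_measure.

End conv_kernel.

Definition conv_unit (k : mtime d) : R.-ker X ~> X :=
  if k == 0%R then (kdirac (@measurable_id _ X setT) : R.-ker X ~> X)
  else (@kzero _ _ X X R : R.-ker X ~> X).

Fixpoint conv_pow (q : mtime d -> R.-ker X ~> X) (n : nat) :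
    mtime d -> R.-ker X ~> X :=
  if n is m.+1 then conv q (conv_pow q m) else conv_unit.

Definition potential (q : mtime d -> R.-ker X ~> X) (k : mtime d) :
    R.-ker X ~> X :=
  kseries (fun n => conv_pow q n k).

Definition renewal_solution (q : mtime d -> R.-ker X ~> X)
    (G L : mtime d -> X -> \bar R) : Prop :=
  [/\ forall k, measurable_fun setT (L k),
      forall k x, 0 <= L k x &
      forall k x, L k x = G k x + conv_fun q L k x].

Definition minimal_renewal_solution (q : mtime d -> R.-ker X ~> X)
    (G L : mtime d -> X -> \bar R) : Prop :=
  renewal_solution q G L /\
  forall L', renewal_solution q G L' -> forall k x, L k x <= L' k x.

End convolution.

Section chain.
Context (d : nat) (dX : measure_display) (X : measurableType dX) (R : realType).
Context (dT : measure_display) (T : measurableType dT) (P : probability T R).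

(** [f] is a version of the conditional probability of the event [E] given the
    sub-sigma-algebra [H]. *)
Definition cond_prob_version (H : set (set T)) (E : set T) (f : T -> \bar R) :
    Prop :=
  (forall Y, measurable Y -> H (f @^-1` Y)) /\
  (forall B, H B -> \int[P]_(w in B) f w = P (E `&` B)).

(** The sigma-algebra generated by J_0, S_0, ..., J_n, S_n. *)
Definition history (J : nat -> {RV P >-> X}) (S : nat -> {RV P >-> mtime d})
    (n : nat) : set (set T) :=
  <<s \bigcup_(i in [set i | (i <= n)%N])
        (preimage_set_system setT (J i) measurable `|`
         preimage_set_system setT (S i) measurable) >>.

(** The event S_(n+1) - S_n = k is written S_(n+1) = S_n + k, which avoids
    subtraction in N^d. *)
Definition markov_renewal_chain (q : mtime d -> R.-ker X ~> X) (x : X)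
    (J : nat -> {RV P >-> X}) (S : nat -> {RV P >-> mtime d}) : Prop :=
  [/\ {ae P, forall w, J 0%N w = x},
      {ae P, forall w, S 0%N w = 0%R} &
      forall (n : nat) (A : set X) (k : mtime d), measurable A ->
        cond_prob_version (history J S n)
          [set w | A (J n.+1 w) /\ S n.+1 w = (S n w + k)%R]
          (fun w => q k (J n w) A)].

End chain.

(* Main.v *)
(** Write [q * F] for [conv_fun q F].  Associativity of the convolution gives
    [psi * G = sum_n q * (... * (q * G))] with [n] factors [q]; monotone
    convergence turns this series into a solution of the renewal equation, and
    by induction its partial sums stay below every non-negative solution.

    For the probabilistic formula, let [M n F] be the expectation of
    [1_(S_n <= k) F_(k - S_n)(J_n)].  Conditioning on the first [n] steps gives
    [M n.+1 F = M n (q * F)], because [sum_k q_k = 1] forces [S_n <= S_(n+1)]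
    almost surely; hence [M n F] is the value at [(k, x)] of [F] convolved [n]
    times with [q], and summing over [n] gives the claim. *)

Require Import Defs.
From HB Require Import structures.
From mathcomp Require Import all_boot all_order all_algebra.
From mathcomp Require Import all_classical all_reals all_analysis.
From mathcomp Require Import measurable_realfun.

Set Implicit Arguments.
Unset Strict Implicit.
Unset Printing Implicit Defensive.

Import Order.TTheory GRing.Theory Num.Theory.
Import numFieldNormedType.Exports.

Local Open Scope classical_set_scope.
Local Open Scope ring_scope.
Local Open Scope ereal_scope.

(** * Integration against a mixture of measures *)

Section mixture.
Context d d' (W : measurableType d) (Y : measurableType d') (R : realType).
Variables (m : {measure set W -> \bar R}) (D : set W) (mD : measurable D).
Variable l : W -> {measure set Y -> \bar R}.
Hypothesis ml : forall U, measurable U -> measurable_fun setT (l ^~ U).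

(* The two proofs are unused arguments: the measure instance below is keyed on
   [mixture] and needs them. *)
Definition mixture of measurable D &
    (forall U, measurable U -> measurable_fun setT (l ^~ U)) :=
  fun U => \int[m]_(w in D) l w U.
Local Notation mix := (mixture mD ml).

Let mixture0 : mix set0 = 0.
Proof. by apply: integral0_eq => w _; rewrite measure0. Qed.

Let mixture_ge0 U : 0 <= mix U.
Proof. exact: integral_ge0. Qed.

Let mixture_sigma_additive : semi_sigma_additive mix.
Proof.
move=> F mF tF mUF; rewrite [X in _ --> X](_ : _ = \sum_(n <oo) mix (F n)).
  exact: is_cvg_nneseries.
rewrite /mixture -integral_nneseries//.
  by apply: eq_integral => w _; rewrite measure_semi_bigcup.
by move=> n; exact/measurable_funTS/ml.
Qed.

HB.instance Definition _ :=
  isMeasure.Build _ _ _ mix mixture0 mixture_ge0 mixture_sigma_additive.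

Import HBNNSimple.

Let integral_mixture_nnsfun (f : {nnsfun Y >-> R}) :
  \int[mix]_y (f y)%:E = \int[m]_(w in D) \int[l w]_y (f y)%:E.
Proof.
rewrite integralT_nnsfun sintegralE.
under [RHS]eq_integral do rewrite integralT_nnsfun sintegralE.
rewrite ge0_integral_fsum//.
- apply: eq_fsbigr => r; rewrite inE => -[y _ <-].
  by rewrite ge0_integralZl_EFin//; exact/measurable_funTS/ml.
- by move=> r; apply: measurable_funeM; exact/measurable_funTS/ml.
- by move=> r w _; exact: nnsfun_mulemu_ge0.
Qed.

(** Linearity gives the case of simple functions; monotone convergence, applied to the mixture, to
    each [l w] and to [m], extends it along an increasing simple approximation of [f]. *)
Lemma ge0_integral_mixture (f : Y -> \bar R) :
  (forall y, 0 <= f y) -> measurable_fun setT f ->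
  \int[mix]_y f y = \int[m]_(w in D) \int[l w]_y f y.
Proof.
move=> f0 mf; pose f_ := nnsfun_approx measurableT mf.
have mf_ n : measurable_fun setT (fun y => (f_ n y)%:E).
  exact/measurable_EFinP.
have f_ge0 n y : 0 <= (f_ n y)%:E by rewrite lee_fin.
have ndf y : {homo (fun n => (f_ n y)%:E) : a b / (a <= b)%N >-> a <= b}.
  by move=> a b ab; rewrite lee_fin; exact/lefP/nd_nnsfun_approx.
have int_lim (mu : {measure set Y -> \bar R}) :
    \int[mu]_y f y = lim (\int[mu]_y (f_ n y)%:E @[n --> \oo]).
  rewrite -monotone_convergence//; apply: eq_integral => y _.
  by apply/esym/cvg_lim => //; exact: cvg_nnsfun_approx.
rewrite int_lim; under eq_fun do rewrite integral_mixture_nnsfun.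
under [RHS]eq_integral do rewrite int_lim.
rewrite monotone_convergence//.
- by move=> n; apply: measurable_funTS; exact: measurable_fun_integral_kernel.
- by move=> n w _; exact: integral_ge0.
- by move=> w _ a b ab; apply: ge0_le_integral => // y _; exact: ndf.
Qed.

End mixture.

(** * Order and arithmetic of time vectors *)

Section mtime_theory.
Context (d : nat).
Implicit Types k r s : mtime d.

Lemma mtime_le_trans s r k : mtime_le r s -> mtime_le s k -> mtime_le r k.
Proof. by move=> rs sk j; exact: leq_trans (rs j) (sk j). Qed.

Lemma mtime_addE r k j : (r + k)%R j = (r j + k j)%N.
Proof. by rewrite ffunE. Qed.

Lemma mtime_add_sub r k : mtime_le r k -> (r + mtime_sub k r)%R = k.
Proof. by move=> rk; apply/ffunP => j; rewrite mtime_addE ffunE subnKC. Qed.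

Lemma mtime_le_addr r k : mtime_le r (r + k)%R.
Proof. by move=> j; rewrite mtime_addE leq_addr. Qed.

Lemma mtime_addI r : injective (fun k => r + k)%R.
Proof.
move=> s t /= /ffunP st; apply/ffunP => j.
by move: (st j); rewrite !mtime_addE => /addnI.
Qed.

Lemma mtime_sub_addl r k : mtime_sub (r + k)%R r = k.
Proof. by apply/ffunP => j; rewrite ffunE mtime_addE addKn. Qed.

Lemma mtime_subDr k r s : mtime_sub k (r + s)%R = mtime_sub (mtime_sub k r) s.
Proof. by apply/ffunP => j; rewrite [LHS]ffunE mtime_addE !ffunE subnDA. Qed.

Lemma mtime_sub0 k : mtime_sub k 0%R = k.
Proof. by apply/ffunP => j; rewrite !ffunE subn0. Qed.

Lemma mtime_le0 k : mtime_le 0%R k.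
Proof. by move=> j; rewrite ffunE. Qed.

Lemma mtime_le_addP k r s :
  mtime_le r k -> mtime_le (r + s)%R k <-> mtime_le s (mtime_sub k r).
Proof.
by move=> rk; split=> h j; have := h j; rewrite mtime_addE ffunE leq_subRL.
Qed.

(** Both sides run over the pairs [(s, t)] with [s + t] below [k], the left one grouped by
    [r = s + t]. This reindexing underlies both the associativity of convolution and the one-step
    recursion of the chain. *)
Lemma mtime_fsbig_triangle (R : realType) k (F : mtime d -> mtime d -> \bar R) :
  \sum_(r \in mtime_box k) \sum_(s \in mtime_box r) F s (mtime_sub r s) =
  \sum_(s \in mtime_box k) \sum_(t \in mtime_box (mtime_sub k s)) F s t.
Proof.
pose H r s := if r \in [set r | mtime_le s r] then F s (mtime_sub r s) else 0.
(* Extending the summand by zero makes the inner index set independent of [r], so that the sums can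
   be exchanged. *)
transitivity (\sum_(r \in mtime_box k) \sum_(s \in mtime_box k) H r s).
  apply: eq_fsbigr => r; rewrite inE => rk.
  rewrite (_ : mtime_box r = mtime_box k `&` mtime_box r); last first.
    by rewrite setIidr// => s sr; exact: mtime_le_trans sr rk.
  rewrite fsbig_mkcondr; apply: eq_fsbigr => s _; rewrite /H.
  by rewrite (_ : (s \in _) = (r \in [set r | mtime_le s r]))//; apply/idP/idP;
    rewrite !inE.
rewrite exchange_fsbig; [|exact: finite_mtime_box..].
apply: eq_fsbigr => s; rewrite inE => sk.
rewrite /H -fsbig_mkcondr.
rewrite (reindex_fsbig (fun t => s + t)%R (mtime_box (mtime_sub k s))).
  by apply: eq_fsbigr => t _; rewrite mtime_sub_addl.
split.
- move=> t /= tk; split; last exact: mtime_le_addr.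
  exact/mtime_le_addP.
- by move=> t u _ _ /mtime_addI.
- move=> r [/= rk sr]; exists (mtime_sub r s); last exact: mtime_add_sub.
  by apply/mtime_le_addP => //; rewrite mtime_add_sub.
Qed.

End mtime_theory.

(** * Convolution of kernels with functions, and the minimal solution *)

Section conv_fun_theory.
Context (d : nat) (dX : measure_display) (X : measurableType dX) (R : realType).
Implicit Types (A B q : mtime d -> R.-ker X ~> X) (F : mtime d -> X -> \bar R).
Implicit Types k : mtime d.

(** The measure on the left is a finite sum, over [r] in the box, of mixtures of [B (mtime_sub k r)]
    under [A r x]. *)
Lemma ge0_integral_conv A B k x (f : X -> \bar R) :
  (forall y, 0 <= f y) -> measurable_fun setT f ->
  \int[Defs.conv A B k x]_y f y =
  \sum_(r \in mtime_box k) \int[A r x]_y \int[B (mtime_sub k r) y]_z f z.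
Proof.
move=> f0 mf; have mB r := measurable_kernel (B (mtime_sub k r)).
(* Listing the box turns the finite sum of measures into an [msum], which is indexed by
   positions. *)
pose s : seq (mtime d) := finmap.enum_fset (fset_set (mtime_box k)).
pose nu i := mixture (A (nth 0%R s i) x) measurableT (mB (nth 0%R s i)).
rewrite (@eq_measure_integral _ _ _ _ (msum nu (size s))).
  rewrite ge0_integral_measure_sum//.
  rewrite fsbig_finite/=; last exact: finite_mtime_box.
  rewrite (big_nth 0%R) big_mkord.
  by apply: eq_bigr => i _; rewrite /nu ge0_integral_mixture.
move=> U mU _; rewrite -[LHS]/(conv_set A B k x U) /conv_set.
rewrite fsbig_finite/=; last exact: finite_mtime_box.
by rewrite (big_nth 0%R) big_mkord.
Qed.

Lemma conv_fun_ge0 A F k x : (forall k y, 0 <= F k y) -> 0 <= conv_fun A F k x.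
Proof. by move=> F0; apply: fsume_ge0 => r _; exact: integral_ge0. Qed.

Lemma measurable_conv_fun A F k : (forall k y, 0 <= F k y) ->
  (forall k, measurable_fun setT (F k)) -> measurable_fun setT (conv_fun A F k).
Proof.
move=> F0 mF; apply: emeasurable_fsum => [|r]; first exact: finite_mtime_box.
by apply: measurable_fun_integral_kernel => // U mU; exact: measurable_kernel.
Qed.

Lemma le_conv_fun A F F' k x :
  (forall k y, 0 <= F k y) -> (forall k, measurable_fun setT (F k)) ->
  (forall k, measurable_fun setT (F' k)) ->
  (forall k y, F k y <= F' k y) -> conv_fun A F k x <= conv_fun A F' k x.
Proof.
move=> F0 mF mF' FF'; apply: lee_fsum => [|r _]; first exact: finite_mtime_box.
by apply: ge0_le_integral.
Qed.

Lemma conv_fun_nneseries A (F : nat -> mtime d -> X -> \bar R) k x :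
  (forall n k y, 0 <= F n k y) ->
  (forall n k, measurable_fun setT (F n k)) ->
  conv_fun A (fun k y => \sum_(n <oo) F n k y) k x =
  \sum_(n <oo) conv_fun A (F n) k x.
Proof.
move=> F0 mF; rewrite /conv_fun.
under eq_fsbigr do rewrite integral_nneseries//.
under eq_eseriesr do (rewrite fsbig_finite/=; last exact: finite_mtime_box).
rewrite fsbig_finite/=; last exact: finite_mtime_box.
by rewrite nneseries_sum// => r n _; exact: integral_ge0.
Qed.

Lemma conv_fun_conv A B F k x : (forall k y, 0 <= F k y) ->
  (forall k, measurable_fun setT (F k)) ->
  conv_fun (Defs.conv A B) F k x = conv_fun A (conv_fun B F) k x.
Proof.
move=> F0 mF; have mBF s t :
    measurable_fun setT (fun y => \int[B s y]_z F t z).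
  by apply: measurable_fun_integral_kernel => // U mU; exact: measurable_kernel.
(* With the lag written as [s + t], the summand depends on the two increments only, as
   [mtime_fsbig_triangle] requires. *)
pose H s t := \int[A s x]_y \int[B t y]_z F (mtime_sub k (s + t)%R) z.
transitivity (\sum_(r \in mtime_box k) \sum_(s \in mtime_box r)
    H s (mtime_sub r s)).
  apply: eq_fsbigr => r _; rewrite (ge0_integral_conv _ _ _ _ (F0 _) (mF _)).
  by apply: eq_fsbigr => s /[!inE] sr; rewrite /H mtime_add_sub.
rewrite mtime_fsbig_triangle; apply: eq_fsbigr => s _.
rewrite ge0_integral_fsum; last 4 first.
- exact: measurableT.
- by move=> t; exact: mBF.
- by move=> t y _; exact: integral_ge0.
- exact: finite_mtime_box.
by apply: eq_fsbigr => t _; rewrite /H mtime_subDr.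
Qed.

Lemma conv_fun_unit F k x : (forall k y, 0 <= F k y) ->
  (forall k, measurable_fun setT (F k)) ->
  conv_fun (@conv_unit d dX X R) F k x = F k x.
Proof.
move=> F0 mF; rewrite /conv_fun (fsbigD1 0%R)/=; last 2 first.
- exact: finite_mtime_box.
- exact: mtime_le0.
rewrite /conv_unit eqxx /= /kdirac integral_dirac// diracT mul1e mtime_sub0.
rewrite fsbig1 ?adde0// => r [_ /eqP r0].
by rewrite (negbTE r0) /= /kzero integral_measure_zero.
Qed.

Lemma iter_conv_fun_ge0 A F n k x : (forall k y, 0 <= F k y) ->
  0 <= iter n (conv_fun A) F k x.
Proof.
move=> F0; elim: n k x => [//|n IHn] k x /=; exact: conv_fun_ge0.
Qed.

Lemma measurable_iter_conv_fun A F n k : (forall k y, 0 <= F k y) ->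
  (forall k, measurable_fun setT (F k)) ->
  measurable_fun setT (iter n (conv_fun A) F k).
Proof.
move=> F0 mF; elim: n k => [//|n IHn] k /=; apply: measurable_conv_fun => //.
by move=> *; exact: iter_conv_fun_ge0.
Qed.

Lemma conv_fun_conv_pow q F n : (forall k y, 0 <= F k y) ->
  (forall k, measurable_fun setT (F k)) ->
  conv_fun (conv_pow q n) F = iter n (conv_fun q) F.
Proof.
move=> F0 mF; elim: n => [|n IHn] /=; apply/funext => k; apply/funext => x.
  exact: conv_fun_unit.
by rewrite conv_fun_conv// IHn.
Qed.

(** Integration against a series of kernels is termwise, and the finite sum over the box commutes
    with a series of non-negative terms. *)
Lemma conv_fun_potential q F k x : (forall k y, 0 <= F k y) ->
  (forall k, measurable_fun setT (F k)) ->
  conv_fun (potential q) F k x = \sum_(n <oo) iter n (conv_fun q) F k x.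
Proof.
move=> F0 mF.
under eq_eseriesr do rewrite -conv_fun_conv_pow//.
rewrite {1}/conv_fun; under eq_fsbigr do rewrite integral_kseries//.
under eq_eseriesr do
  (rewrite /conv_fun fsbig_finite/=; last exact: finite_mtime_box).
rewrite fsbig_finite/=; last exact: finite_mtime_box.
by rewrite nneseries_sum// => r n _; exact: integral_ge0.
Qed.

Lemma potential_minimal_solution q F : (forall k y, 0 <= F k y) ->
  (forall k, measurable_fun setT (F k)) ->
  minimal_renewal_solution q F (conv_fun (potential q) F).
Proof.
move=> F0 mF; split; first split.
- by move=> k; exact: measurable_conv_fun.
- by move=> k x; exact: conv_fun_ge0.
(* The term of index 0 is [F k x]; the remaining terms, shifted by one, form [q] convolved with the
   whole series. *)
- move=> k x; rewrite conv_fun_potential// nneseries_recl//; last first.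
    by move=> n _; exact: iter_conv_fun_ge0.
  congr (_ + _).
  rewrite [X in conv_fun q X](_ : _ =
      (fun k y => \sum_(n <oo) iter n (conv_fun q) F k y)); last first.
    by apply/funext => s; apply/funext => y; rewrite conv_fun_potential.
  rewrite conv_fun_nneseries.
  + by rewrite -(nneseries_addn 1)//; [under eq_eseriesr do rewrite addn1|
      move=> n; exact: iter_conv_fun_ge0].
  + by move=> *; exact: iter_conv_fun_ge0.
  + by move=> *; exact: measurable_iter_conv_fun.
- move=> L' [mL' L'0 L'E] k x; rewrite conv_fun_potential//.
  (* It suffices to bound the partial sums. The one with [n.+1] terms is [F] plus [q] convolved with
     the one with [n] terms, so the equation for [L'] and monotonicity of convolution close the
     induction. *)
  apply: lime_le.
    by apply: is_cvg_nneseries => n _ _; exact: iter_conv_fun_ge0.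
  apply: nearW => n /=; elim: n k x => [|n IHn] k x; first by rewrite big_geq.
  rewrite big_nat_recl//= L'E leeD2l//.
  apply: le_trans (le_conv_fun (F := fun k y =>
    \sum_(0 <= i < n) iter i (conv_fun q) F k y) _ _ _ _ _ _ IHn); last first.
  + exact: mL'.
  + by move=> s; apply: emeasurable_sum => i; exact: measurable_iter_conv_fun.
  + by move=> s y; apply: sume_ge0 => i _; exact: iter_conv_fun_ge0.
  rewrite /conv_fun.
  under [leRHS]eq_fsbigr.
    move=> r _; rewrite ge0_integral_sum//; last 2 first.
      by move=> i; exact: measurable_iter_conv_fun.
      by move=> i y _; exact: iter_conv_fun_ge0.
    over.
  rewrite fsbig_finite/=; last exact: finite_mtime_box.
  rewrite exchange_big /=.
  under eq_bigr => i _ do (rewrite fsbig_finite; last exact: finite_mtime_box).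
  by [].
Qed.

End conv_fun_theory.

Lemma integral_indicM d (T : measurableType d) (R : realType)
    (mu : {measure set T -> \bar R}) (D : set T) (f : T -> \bar R) :
  \int[mu]_w ((\1_D w)%:E * f w) = \int[mu]_(w in D) f w.
Proof.
rewrite [RHS]integral_mkcond; apply: eq_integral => w _.
by rewrite indicE patchE; case: ifPn => _; rewrite ?mul1e ?mul0e.
Qed.

(** * The reward collected at one renewal *)

Section reward.
Context (d : nat) (dX : measure_display) (X : measurableType dX) (R : realType).
Variables (k : mtime d) (F : mtime d -> X -> \bar R).
Hypotheses (F0 : forall k y, 0 <= F k y)
  (mF : forall k, measurable_fun setT (F k)).

(** The summand of the probabilistic formula. Outside the box the indicator discards the value at
    the truncated difference. *)
Definition reward (y : X) (s : mtime d) : \bar R :=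
  (\1_(mtime_box k) s)%:E * F (mtime_sub k s) y.

Lemma reward_ge0 y s : 0 <= reward y s.
Proof. by rewrite mule_ge0// lee_fin. Qed.

(** Only [u = s] can contribute. The finite sum separates the two variables, which gives
    measurability along the chain and lets the expectation be split by the value of [S]. *)
Lemma rewardE y s : reward y s =
  \sum_(u \in mtime_box k) (\1_[set u] s)%:E * F (mtime_sub k u) y.
Proof.
rewrite /reward; have [sk|sk] := pselect (mtime_le s k).
  rewrite (fsbigD1 s)//=; last exact: finite_mtime_box.
  rewrite fsbig1 => [|u [_ /eqP us]].
    by rewrite adde0 !indicE !mem_set.
  by rewrite indicE memNset ?mul0e// => /= /esym/eqP; exact/negP.
rewrite fsbig1 => [|u uk]; first by rewrite indicE memNset// mul0e.
by rewrite indicE memNset ?mul0e// => /= su; apply: sk; rewrite su.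
Qed.

Context dT (T : measurableType dT) (P : {measure set T -> \bar R}).
Variables (J : {mfun T >-> X}) (S : {mfun T >-> mtime d}).

Let measurable_term u : measurable_fun setT
  (fun w => (\1_[set u] (S w))%:E * F (mtime_sub k u) (J w)).
Proof.
apply: emeasurable_funM; last exact: measurableT_comp.
apply/measurable_EFinP; apply: (@measurable_indic _ _ _ _ (S @^-1` [set u])).
by rewrite -[X in measurable X]setTI; exact: measurable_funP.
Qed.

Lemma measurable_reward : measurable_fun setT (fun w => reward (J w) (S w)).
Proof.
under eq_fun do rewrite rewardE.
by apply: emeasurable_fsum => //; exact: finite_mtime_box.
Qed.

Lemma integral_reward : \int[P]_w reward (J w) (S w) =
  \sum_(u \in mtime_box k)
    \int[P]_(w in S @^-1` [set u]) F (mtime_sub k u) (J w).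
Proof.
under eq_integral do rewrite rewardE.
rewrite ge0_integral_fsum//; last 2 first.
- by move=> u w _; rewrite mule_ge0// lee_fin.
- exact: finite_mtime_box.
apply: eq_fsbigr => u _; rewrite -[RHS]integral_indicM.
by apply: eq_integral => w _; rewrite !indicE.
Qed.

End reward.

(** * Expected rewards along the Markov renewal chain *)

Section markov_renewal_chain.
Context (d : nat) (dX : measure_display) (X : measurableType dX) (R : realType).
Context (dT : measure_display) (T : measurableType dT) (P : probability T R).
Variables (q : mtime d -> R.-ker X ~> X) (x : X).
Variables (J : nat -> {RV P >-> X}) (S : nat -> {RV P >-> mtime d}).
Hypothesis chainJS : markov_renewal_chain q x J S.

Let measurable_preS n (A : set (mtime d)) : measurable (S n @^-1` A).
Proof. by rewrite -[X in measurable X]setTI; exact: measurable_funP. Qed.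

Let historyS n s : history J S n (S n @^-1` [set s]).
Proof.
apply: sub_sigma_algebra; exists n => //=; right.
by exists [set s] => //; rewrite setTI.
Qed.

(* Both sides are integrals of [f] against mixtures, of Dirac masses at
   [J_(n+1)] and of [q r (J_n)] respectively, and the defining property of the
   chain says that these two measures agree on measurable sets. *)
Lemma chain_step n s r (f : X -> \bar R) :
  (forall y, 0 <= f y) -> measurable_fun setT f ->
  \int[P]_(w in S n @^-1` [set s] `&` S n.+1 @^-1` [set (s + r)%R])
    f (J n.+1 w) =
  \int[P]_(w in S n @^-1` [set s]) \int[q r (J n w)]_y f y.
Proof.
move=> f0 mf; set B := S n @^-1` [set s]; set D := B `&` _.
have mB : measurable B by exact: measurable_preS.
have mD : measurable D by exact: measurableI.
pose delta w : {measure set X -> \bar R} := \d_(J n.+1 w).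
have mdelta U : measurable U -> measurable_fun setT (delta ^~ U).
  move=> mU; apply/measurable_EFinP.
  apply: (@measurable_indic _ _ _ _ (J n.+1 @^-1` U)).
  by rewrite -[X in measurable X]setTI; exact: measurable_funP.
have mq U : measurable U -> measurable_fun setT (fun w => q r (J n w) U).
    move=> mU.
  apply: (measurableT_comp (measurable_kernel (q r) U mU)).
  exact: measurable_funP.
transitivity (\int[mixture P mD mdelta]_y f y).
  rewrite ge0_integral_mixture//; apply: eq_integral => w _.
  by rewrite integral_dirac// diracT mul1e.
rewrite -(ge0_integral_mixture P mB mq)//; apply: eq_measure_integral => A mA _.
have [_ _ /(_ n A r mA) [_ /(_ B (@historyS n s)) stepA]] := chainJS.
rewrite [RHS]stepA -[LHS]/(\int[P]_(w in D) (\1_A (J n.+1 w))%:E).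
rewrite [LHS](_ : _ = \int[P]_(w in D) (\1_(J n.+1 @^-1` A) w)%:E)//.
rewrite integral_indic//; last first.
  by rewrite -[X in measurable X]setTI; exact: measurable_funP.
congr (P _); apply/seteqP; split => w /=.
  by move=> [Aw [Bw Sw]]; split=> //; split=> //; rewrite Sw Bw.
by move=> [[Aw Sw] Bw]; split=> //; split=> //=; rewrite Sw Bw.
Qed.

(** The events that the increment equals [r] are disjoint, and their probabilities add up to the
    expectation of the total mass of [q] at [J n], which is 1. *)
Lemma chain_increasing n : semi_markov q ->
  {ae P, forall w, mtime_le (S n w) (S n.+1 w)}.
Proof.
move=> q1.
pose E r := [set w | S n.+1 w = (S n w + r)%R].
have mE r : measurable (E r).
  rewrite (_ : E r = \bigcup_(s in [set: mtime d])
      (S n @^-1` [set s] `&` S n.+1 @^-1` [set (s + r)%R])).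
    apply: countable_bigcupT_measurable => [|s]; first exact: countableP.
    exact: measurableI.
  apply/seteqP; split=> w /=; first by exists (S n w).
  by move=> [s _ [/= <-]].
have PE r : P (E r) = \int[P]_w q r (J n w) setT.
  (* The conditioning event is the whole space, which lies in the history as the preimage of [setT]
     under [J 0]. *)
  have [_ _ /(_ n setT r measurableT) [_ /(_ setT) ->]] := chainJS.
    by rewrite setIT; congr (P _); apply/seteqP; split=> w //= [].
  apply: sub_sigma_algebra; exists 0%N => //=; left; exists setT => //.
  by rewrite setTI preimage_setT.
(* [N^d] is enumerated through [pickle] so that the countable unions and sums
   below are indexed by [nat]. *)
pose e i : option (mtime d) := @pickle_inv {ffun 'I_d -> nat} i.
pose E' i := if e i is Some r then E r else set0.
pose g i y := if e i is Some r then q r y setT else 0.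
have sumg y : \sum_(i <oo) g i y = 1.
  rewrite -(q1 y) nneseries_esumT; last by move=> i; rewrite /g; case: (e i).
  (* Indices that encode no vector contribute 0; on the others [pickle] is a bijective
     reindexing. *)
  rewrite (esumID [set i | e i]) ?setTI; last first.
    by move=> i _; rewrite /g; case: (e i).
  rewrite [X in _ + X]esum1 ?adde0; last first.
    by move=> i /=; rewrite /g; case: (e i).
  rewrite (reindex_esum [set: mtime d] _ (@pickle {ffun 'I_d -> nat})).
    by apply: eq_esum => r _; rewrite /g /e pickleK_inv.
  split=> //=.
  - by move=> r _; rewrite /e /= pickleK_inv.
  - move=> i; rewrite /e /=; case ei : (pickle_inv i) => [r|]// _.
    exists r => //.
    by have := pickle_invK (T := {ffun 'I_d -> nat}) i; rewrite ei.
have mE' i : measurable (E' i) by rewrite /E'; case: (e i).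
have mU : measurable (\bigcup_i E' i) by exact: bigcup_measurable.
have PE' : P (\bigcup_i E' i) = 1.
  rewrite measure_semi_bigcup//; last first.
  - move=> i j _ _ [w []]; rewrite /E' /e.
    have := pickle_invK (T := {ffun 'I_d -> nat}) i.
    have := pickle_invK (T := {ffun 'I_d -> nat}) j.
    case: pickle_inv => [s|//] /= <-; case: pickle_inv => [r|//] /= <-.
    by rewrite /E /= => -> /mtime_addI ->.
  rewrite (eq_eseriesr (g := fun i => \int[P]_w g i (J n w))); last first.
    move=> i _; rewrite /E' /g; case: (e i) => [r|]; first exact: PE.
    by rewrite measure0 integral0.
  rewrite -integral_nneseries//.
  + under eq_integral do rewrite sumg.
    by rewrite integral_cst// mul1e; exact: probability_setT.
  + move=> i; rewrite /g; case: (e i) => [r|]//.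
    apply: (measurableT_comp (measurable_kernel (q r) setT measurableT)).
    exact: measurable_funP.
  + by move=> i w _; rewrite /g; case: (e i).
exists (~` \bigcup_i E' i); split; first exact: measurableC.
  by rewrite probability_setC// PE' subee.
move=> w /= + [i _]; rewrite /E'; case: (e i) => [r|//]; rewrite /E /= => + Sw.
by apply; rewrite Sw; exact: mtime_le_addr.
Qed.

(** The event is split by the value [s] of [S n]. Almost surely [s] lies below [u], so a finite sum
    suffices, and [chain_step] evaluates each piece. *)
Lemma integral_increment n u (f : X -> \bar R) : semi_markov q ->
  (forall y, 0 <= f y) -> measurable_fun setT f ->
  \int[P]_(w in S n.+1 @^-1` [set u]) f (J n.+1 w) =
  \sum_(s \in mtime_box u)
    \int[P]_(w in S n @^-1` [set s]) \int[q (mtime_sub u s) (J n w)]_y f y.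
Proof.
move=> q1 f0 mf; pose D s := S n @^-1` [set s] `&` S n.+1 @^-1` [set u].
have m1 A : measurable A -> measurable_fun setT
    (fun w => (\1_A w)%:E * f (J n.+1 w)).
  move=> mA; apply: emeasurable_funM.
    exact/measurable_EFinP/measurable_indic.
  by apply: (measurableT_comp mf); exact: measurable_funP.
have ge1 A w : 0 <= (\1_A w)%:E * f (J n.+1 w) by rewrite mule_ge0// lee_fin.
have mD s : measurable (D s) by apply: measurableI; exact: measurable_preS.
transitivity
  (\int[P]_w \sum_(s \in mtime_box u) (\1_(D s) w)%:E * f (J n.+1 w)).
  rewrite -[LHS]integral_indicM; apply: ge0_ae_eq_integral => //.
  - by apply: m1; exact: measurable_preS.
  - apply: emeasurable_fsum => [|s]; first exact: finite_mtime_box.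
    exact: m1.
  - by move=> w _; apply: fsume_ge0.
  (* Where [S n.+1 w = u], monotonicity puts [S n w] in the box of [u], so exactly one indicator is
     1; elsewhere all of them vanish. *)
  - apply: filterS (chain_increasing n q1) => w Sw _.
    have [Su|Su] := pselect (S n.+1 w = u); last first.
      rewrite indicE memNset// mul0e fsbig1// => s _.
      by rewrite indicE memNset ?mul0e// => -[].
    rewrite (fsbigD1 (S n w))/=; last 2 first.
    + exact: finite_mtime_box.
    + by rewrite -Su.
    rewrite fsbig1 => [|s [_ sS]]; last first.
      by rewrite indicE memNset ?mul0e// => -[/= Ss _]; apply: sS.
    by rewrite adde0 !indicE !mem_set.
rewrite ge0_integral_fsum//; last 2 first.
- by move=> s; exact: m1.
- exact: finite_mtime_box.
apply: eq_fsbigr => s /[!inE] su.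
by rewrite integral_indicM -chain_step// /D mtime_add_sub.
Qed.

(** The same reindexing as in [conv_fun_conv], with the law of [(J n, S n)] in place of the left
    kernel. *)
Lemma integral_reward_conv n k F : semi_markov q ->
  (forall k y, 0 <= F k y) -> (forall k, measurable_fun setT (F k)) ->
  \int[P]_w reward k F (J n.+1 w) (S n.+1 w) =
  \int[P]_w reward k (conv_fun q F) (J n w) (S n w).
Proof.
move=> q1 F0 mF; rewrite !integral_reward//; last 2 first.
- by move=> *; exact: conv_fun_ge0.
- by move=> *; exact: measurable_conv_fun.
pose H s t := \int[P]_(w in S n @^-1` [set s])
  \int[q t (J n w)]_y F (mtime_sub k (s + t)%R) y.
transitivity (\sum_(u \in mtime_box k) \sum_(s \in mtime_box u)
    H s (mtime_sub u s)).
  apply: eq_fsbigr => u _; rewrite (integral_increment _ _ q1 (F0 _) (mF _)).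
  by apply: eq_fsbigr => s /[!inE] su; rewrite /H mtime_add_sub.
rewrite mtime_fsbig_triangle; apply: eq_fsbigr => s _.
rewrite ge0_integral_fsum; last 4 first.
- exact: measurable_preS.
- move=> t; apply: measurable_funTS.
  apply: (measurableT_comp (f := fun y => \int[q t y]_z _ z)); last first.
    exact: measurable_funP.
  by apply: measurable_fun_integral_kernel => // U mU; exact: measurable_kernel.
- by move=> t w _; exact: integral_ge0.
- exact: finite_mtime_box.
by apply: eq_fsbigr => t _; rewrite /H mtime_subDr.
Qed.

Lemma integral_reward_iter n k F : semi_markov q ->
  (forall k y, 0 <= F k y) -> (forall k, measurable_fun setT (F k)) ->
  \int[P]_w reward k F (J n w) (S n w) = iter n (conv_fun q) F k x.
Proof.
(* [F] stays general because the induction hypothesis is applied to [conv_fun q F]. *)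
move=> q1; elim: n F => [|n IHn] F F0 mF; last first.
  rewrite integral_reward_conv// IHn -?iterSr//.
  - by move=> *; exact: conv_fun_ge0.
  - by move=> *; exact: measurable_conv_fun.
have [J0 S0 _] := chainJS.
(* At time 0 the chain sits almost surely at [(x, 0)], so the reward is the constant [F k x]. *)
transitivity (\int[P]_w F k x); last first.
  by rewrite integral_cst// [X in _ * X]probability_setT mule1.
apply: ge0_ae_eq_integral => //.
- exact: measurable_reward.
- by move=> w _; exact: reward_ge0.
- apply: filterS2 J0 S0 => w -> -> _ /=.
  by rewrite /reward indicE mem_set ?mul1e ?mtime_sub0//; exact: mtime_le0.
Qed.

End markov_renewal_chain.

Theorem proposition2p9 (R : realType) (d : nat) (d_ge1 : (1 <= d)%N)
    (dX : measure_display) (X : measurableType dX)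
    (X_standard : standard_borel R X)
    (q : mtime d -> R.-ker X ~> X) (q_semi_markov : semi_markov q)
    (G : mtime d -> X -> \bar R)
    (G_measurable : forall k, measurable_fun [set: X] (G k))
    (G_ge0 : forall k x, 0 <= G k x) :
  minimal_renewal_solution q G (conv_fun (potential q) G) /\
  (forall (dT : measure_display) (T : measurableType dT)
      (P : probability T R) (x : X)
      (J : nat -> {RV P >-> X}) (S : nat -> {RV P >-> mtime d}),
    markov_renewal_chain q x J S ->
    forall k : mtime d,
      conv_fun (potential q) G k x =
      \int[P]_w \sum_(0 <= n <oo)
        (\1_(mtime_box k) (S n w))%:E * G (mtime_sub k (S n w)) (J n w)).
Proof.
split=> [|dT T P x J S chainJS k]; first exact: potential_minimal_solution.
(* Expectation and series commute by non-negativity, so the two series can be compared term by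
   term. *)
rewrite conv_fun_potential// integral_nneseries//.
- by apply: eq_eseriesr => n _; rewrite -(integral_reward_iter chainJS).
- by move=> n; exact: measurable_reward.
- by move=> n w _; exact: reward_ge0.
Qed.
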